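(* Let $n > 1$ be an integer and let $A, B \subseteq \mathbb{Z}$ satisfy $0 \in A \cap B$, $A \oplus B = [n]$ and $\max A > \max B$. Then $A$ is periodic mod $n$.
   Context: Notation: $[n] = \{0,1,\ldots,n-1\}$, and $\mathbb{Z}_n$ is the additive group of integers mod $n$. For $A, B, E \subseteq \mathbb{Z}$, write $A \oplus B = E$ if every sum $a+b$ ($a\in A$, $b\in B$) lies in $E$ and every $g \in E$ has a unique representation $g = a + b$ with $a \in A$, $b \in B$. A set $A$ of integers is periodic mod $n$ if its image $\bar A$ in $\mathbb{Z}_n$ satisfies $\bar A = \bar A + t$ for some $t \in \mathbb{Z}_n \setminus \{0\}$. *)

(* Defs.v *)
From mathcomp Require Export all_boot all_order all_algebra.
From mathcomp Require Export classical_sets.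

Set Implicit Arguments.
Unset Strict Implicit.
Unset Printing Implicit Defensive.

Import GRing.Theory Num.Theory.
Local Open Scope classical_set_scope.
Local Open Scope ring_scope.

Definition interval_set (n : nat) : set int := [set k | 0 <= k < n%:Z].

Definition direct_sum (A B E : set int) : Prop :=
  (forall a b, A a -> B b -> E (a + b)) /\
  (forall g, E g ->
     exists! p : int * int, [/\ A p.1, B p.2 & g = p.1 + p.2]).

Definition is_max (A : set int) (m : int) : Prop := A m /\ ubound A m.

(* 'Z_n is Z/nZ only for n > 1: both 'Z_0 and 'Z_1 are Z/2Z. *)
Definition image_mod (n : nat) (A : set int) : set 'Z_n :=
  [set a%:~R | a in A].
Arguments image_mod n A : clear implicits.

Definition periodic_mod (n : nat) (A : set int) : Prop :=
  exists t : 'Z_n,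
    t != 0 /\ image_mod n A = [set x + t | x in image_mod n A].

(* Main.v *)
Require Import Defs.
From mathcomp Require Import boolp zify.
Import GRing.Theory Num.Theory.
Local Open Scope classical_set_scope.
Local Open Scope ring_scope.

(** De Bruijn's argument.  Say 1 lies in A and let m be the least positive
    element of B (if there is none, A = [n]).  Then B consists of multiples of m
    and A is a union of blocks [km, (k+1)m), so dividing by m gives a tiling of
    [n/m].  By induction there is a proper divisor m of n such that one of the
    two sets lies in [m] and the other one is m-periodic in [n].  The latter set
    contains n - m, so it is the one with the larger maximum. *)

(** * Tilings of [n] by sets of natural numbers *)

Section NatTilings.
Set Implicit Arguments.
Unset Strict Implicit.
Local Open Scope nat_scope.
Implicit Types (A B : pred nat) (n m : nat).

Definition tiling n A B : Prop :=
  [/\ forall a b, A a -> B b -> a + b < n,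
      forall g, g < n -> exists a b, [/\ A a, B b & a + b = g]
    & forall a b c d, A a -> B b -> A c -> B d -> a + b = c + d ->
        a = c /\ b = d].

Lemma tiling_sym n A B : tiling n A B -> tiling n B A.
Proof.
case=> lt_n ex_n uniq_n; split.
- by move=> a b Ba Ab; rewrite addnC; apply: lt_n.
- move=> g /ex_n [a [b [Aa Bb <-]]]; exists b, a; split=> //; exact: addnC.
- move=> a b c d Ba Ab Bc Ad e; suff [] : b = d /\ a = c by [].
  by apply: (uniq_n b a d c) => //; lia.
Qed.

Lemma tiling_zero n A B : 0 < n -> tiling n A B -> A 0 /\ B 0.
Proof.
move=> n0 [_ ex_n _]; have [a [b [Aa Bb e]]] := ex_n _ n0.
have [a0 b0] : a = 0 /\ b = 0 by lia.
by rewrite -{1}a0 -b0.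
Qed.

(** * Block structure relative to the least positive element [m] of [B] *)

Section Blocks.
Variables (n m : nat) (A B : pred nat).
Hypothesis tAB : tiling n A B.
Hypotheses (A0 : A 0) (B0 : B 0) (m_gt0 : 0 < m) (Bm : B m).
Hypothesis m_min : forall b, B b -> 0 < b -> m <= b.

Let lt_n a b : A a -> B b -> a + b < n.
Proof. by case: tAB => h _ _; apply: h. Qed.

Let ex_n g : g < n -> exists a b, [/\ A a, B b & a + b = g].
Proof. by case: tAB => _ h _; apply: h. Qed.

Let uniq_n a b c d : A a -> B b -> A c -> B d -> a + b = c + d ->
  a = c /\ b = d.
Proof. by case: tAB => _ _ h; apply: h. Qed.

(** A sum equal to [i] has no room for a positive element of [B], so its second term is 0. *)
Let A_small i : i < m -> A i.
Proof.
move=> lt_im; have := lt_n A0 Bm; rewrite add0n => lt_mn.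
have [a [b [Aa Bb e]]] := ex_n (ltn_trans lt_im lt_mn).
have [b0|b0] := posnP b; first by have -> : i = a by lia.
by have := m_min Bb b0; lia.
Qed.

(* Otherwise [m * k + m] would also be the sum [(m - i) + (m * k + i)]. *)
Let notB_after k i : A (m * k) -> 0 < i < m -> ~ B (m * k + i).
Proof.
move=> Ak /andP[i0 im] Bki; have Ami : A (m - i) by apply: A_small; lia.
by have [] := uniq_n Ami Bki Ak Bm; [lia | case: k {Ak Bki} => [|k]; nia].
Qed.

(** Strong induction on [k]. The two halves go together: each step needs both the blocks of [A] and
    the divisibility of elements of [B] below [m * k]. The case split is on the representation
    [a + b] of [m * k]. *)
Let block k : (forall i, i < m -> A (m * k + i) = A (m * k)) /\
              (forall i, 0 < i < m -> ~ B (m * k + i)).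
Proof.
have [h IH] := ubnP k; elim: h k IH => // h IHh k lt_kh.
have {h IHh lt_kh} IH j : j < k -> (forall i, i < m -> A (m * j + i) = A (m * j))
    /\ (forall i, 0 < i < m -> ~ B (m * j + i)).
  by move=> ltjk; apply: IHh; lia.
have A_below a : a < m * k -> A a = A (m * (a %/ m)).
  move=> lt_a; have [|hA _] := IH (a %/ m).
    by rewrite ltn_divLR // mulnC.
  by rewrite -(hA (a %% m)) ?ltn_pmod // [m * _]mulnC -divn_eq.
have B_below b : b < m * k -> B b -> m %| b.
  move=> lt_b Bb; have [|_ hB] := IH (b %/ m).
    by rewrite ltn_divLR // mulnC.
  rewrite /dvdn; case: (posnP (b %% m)) => // r0; case: (hB (b %% m)).
    by rewrite r0 ltn_pmod.
  by rewrite [m * _]mulnC -divn_eq.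
have out_of_range : n <= m * k -> (forall i, ~ A (m * k + i)) /\
    (forall i, ~ B (m * k + i)).
  move=> le_n; split=> i Hi.
    by have := lt_n Hi B0; lia.
  by have := lt_n A0 Hi; lia.
have [/out_of_range[nA nB]|lt_kn] := leqP n (m * k).
  split=> i _; last exact: nB.
  by rewrite (negbTE (introN idP (nA i))) -[m * k]addn0 (negbTE (introN idP (nA 0))).
have [a [b [Aa Bb e]]] := ex_n lt_kn.
have [b0|b_gt0] := posnP b.
  have Ak : A (m * k) by have <- : a = m * k by lia.
  split=> i; last exact: notB_after.
  (* Since [m] is in [B], even [m * k + m] is a sum and hence below [n]. *)
  move=> lt_im; rewrite Ak; have lt_n' : m * k + i < n.
    by have := lt_n Ak Bm; lia.
  have [c [d [Ac Bd ecd]]] := ex_n lt_n'.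
  have [lt_c|le_c] := ltnP c (m * k); last first.
    have [d0|d0] := posnP d; first by have <- : c = m * k + i by lia.
    by have := m_min Bd d0; lia.
  have [lt_d|le_d] := ltnP d (m * k).
    (* Here [c] is [i] modulo [m]. Rounding [c] down to a multiple of [m] stays in [A] and gives a
       second representation of [m * k], so [d = 0], against [c < m * k]. *)
    have /dvdnP[q eq_d] := B_below _ lt_d Bd.
    have := Ac; rewrite A_below // => Ac'.
    have [|_ d0] := uniq_n Ac' Bd Ak B0; last by lia.
    have Ei : i = c %% m.
      rewrite -(modn_small lt_im) -(modnMDl k i m) mulnC -ecd eq_d addnC.
      by rewrite modnMDl.
    by have := divn_eq c m; lia.
  (* Now [d >= m * k], so [c <= i]. Equality would put the positive number [m * k] in both sets. *)
  have [eq_ci|ne_ci] := eqVneq c i.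
    have Bk : B (m * k) by have <- : d = m * k by lia.
    by have [] := uniq_n A0 Bk Ak B0; lia.
  case: (@notB_after k (i - c)) => //; first by lia.
  by have <- : d = m * k + (i - c) by lia.
(* If [m * k] is not in A then every element of its block is a sum with a
   nonzero second term, so the block misses A. *)
suff [c [d [Ac Bd d0 ecd]]] : exists c d,
    [/\ forall i, i < m -> A (c + i), B d, 0 < d & c + d = m * k].
  have nA i : i < m -> ~ A (m * k + i).
    move=> lt_im Aki; have := uniq_n (Ac i lt_im) Bd Aki B0; lia.
  split=> i lt_im.
    rewrite (negbTE (introN idP (nA i lt_im))).
    by rewrite -[m * k]addn0 (negbTE (introN idP (nA 0 m_gt0))).
  move=> Bki; have /andP[i0 im] := lt_im.
  by have [] := uniq_n (Ac i im) Bd A0 Bki; lia.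
(* If [b < m * k], then [a] is a multiple of [m] in an earlier block, which lies in [A] by
   induction. Otherwise [a = 0], and the block is [0, m). *)
have [lt_b|le_b] := ltnP b (m * k).
  exists a, b; split=> //.
  have lt_a : a < m * k by lia.
  have /dvdnP[q eq_b] := B_below _ lt_b Bb.
  have a_eq : a = m * (k - q) by nia.
  have [|hA _] := IH (k - q); first by nia.
  by move=> i lt_im; rewrite a_eq hA // -a_eq.
by exists 0, b; split=> //; lia.
Qed.

Lemma tiling_block x : A x = A (m * (x %/ m)).
Proof.
have [hA _] := block (x %/ m).
by rewrite -(hA (x %% m)) ?ltn_pmod // [m * _]mulnC -divn_eq.
Qed.

Lemma tiling_multiple b : B b -> m %| b.
Proof.
move=> Bb; have [_ hB] := block (b %/ m).
rewrite /dvdn; case: (posnP (b %% m)) => // r0; case: (hB (b %% m)).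
  by rewrite r0 ltn_pmod.
by rewrite [m * _]mulnC -divn_eq.
Qed.

(** Write [n - 1] as [a + b]. The last element of the block of [a] is in [A], and its sum with [b]
    is still below [n], so [a] is that last element. *)
Lemma tiling_dvd : m %| n.
Proof.
have n0 : 0 < n by apply: leq_ltn_trans (lt_n A0 B0).
have [a [b [Aa Bb e]]] := @ex_n n.-1 ltac:(by rewrite prednK).
have Aa' : A (m * (a %/ m) + m.-1).
  by have [hA _] := block (a %/ m); rewrite hA -?tiling_block ?prednK.
have lt_s := lt_n Aa' Bb.
have /dvdnP[q eq_b] := tiling_multiple Bb.
have ea := divn_eq a m; have lt_r := ltn_pmod a m_gt0.
by apply/dvdnP; exists (a %/ m + q).+1; nia.
Qed.

Lemma tiling_quotient :
  tiling (n %/ m) (fun x => A (m * x)) (fun x => B (m * x)).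
Proof.
have /dvdnP[q eq_n] := tiling_dvd; split.
- move=> a b Aa Bb; have := lt_n Aa Bb; rewrite eq_n mulnK // -mulnDr.
  by rewrite [q * m]mulnC ltn_mul2l m_gt0.
- move=> g; rewrite eq_n mulnK // => lt_g.
  have [a [b [Aa Bb e]]] := @ex_n (m * g) ltac:(nia).
  have /dvdnP[b' eq_b] := tiling_multiple Bb.
  have /dvdnP[a' eq_a] : m %| a.
    by rewrite -(dvdn_addl (n := b)) ?e ?dvdn_mulr ?tiling_multiple.
  exists a', b'; rewrite ![m * _]mulnC -eq_a -eq_b; split=> //; nia.
- move=> a b c d Aa Bb Ac Bd e; have := uniq_n Aa Bb Ac Bd.
  rewrite -!mulnDr e => /(_ erefl)[/eqP+ /eqP].
  by rewrite !eqn_pmul2l // => /eqP-> /eqP->.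
Qed.

End Blocks.

(** * Induction on [n]: one of the two sets is periodic *)

Definition top_period n m A B : Prop :=
  (forall b, B b -> b < m) /\ (forall x, x < n -> A x = A (x %% m)).

Lemma tiling_top_period n A B : 1 < n -> tiling n A B ->
  exists m, [/\ 0 < m, m < n, m %| n
    & top_period n m A B \/ top_period n m B A].
Proof.
have [h IH] := ubnP n; elim: h n A B IH => // h IHh n A B lt_nh n1 tAB.
(* The number 1 lies in one of the sets, and the conclusion is symmetric in them. *)
wlog A1 : A B tAB / A 1.
  move=> IHAB; have [_ ex_n _] := tAB; have [a [b [Aa Bb e]]] := ex_n _ n1.
  have [A0 B0] := tiling_zero (ltnW n1) tAB.
  have [a1|[a0 b1]] : a = 1 \/ a = 0 /\ b = 1 by lia.
    by apply: IHAB; rewrite // -a1.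
  have [||m [m0 mn dvd_mn H]] := IHAB B A; first exact: tiling_sym.
    by rewrite -b1.
  by exists m; split=> //; case: H; [right|left].
have [A0 B0] := tiling_zero (ltnW n1) tAB.
have [lt_n ex_n uniq_n] := tAB.
have [exB|nexB] := pselect (exists b, B b && (0 < b)); last first.
  have B_eq0 b : B b -> b = 0.
    by move=> Bb; case: (posnP b) => // b0; case: nexB; exists b; rewrite Bb.
  exists 1; split=> //; left; split=> [b /B_eq0->//|x lt_x].
  rewrite modn1 A0; have [a [b [Aa /B_eq0 b0 <-]]] := ex_n _ lt_x.
  by rewrite b0 addn0.
case: (ex_minnP exB) => m /andP[Bm m0] min_m.
have m_min b : B b -> 0 < b -> m <= b by move=> Bb b0; apply: min_m; rewrite Bb.
(* This makes the quotient [q] smaller than [n], as the induction requires. *)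
have m1 : 1 < m.
  have [//|le_m1] := ltnP 1 m; have m_eq1 : m = 1 by lia.
  by have [] := uniq_n 0 m 1 0 A0 Bm A1 B0; lia.
have lt_mn : m < n by have := lt_n _ _ A0 Bm.
have blockA := tiling_block tAB A0 B0 m0 Bm m_min.
have multB := tiling_multiple tAB A0 B0 m0 Bm m_min.
have /dvdnP[q eq_n] := tiling_dvd tAB A0 B0 m0 Bm m_min.
have tq := tiling_quotient tAB A0 B0 m0 Bm m_min.
rewrite eq_n mulnK // in tq.
have lt_qh : q < h by nia.
have q1 : 1 < q by nia.
have [m' [m'0 lt_m'q dvd_m' H]] := IHh _ _ _ lt_qh q1 tq.
have div_mod x : x %% (m * m') %/ m = x %/ m %% m'.
  by rewrite mulnC -modn_divl.
(* A period [m'] of the quotient tiling scales up by the block length [m]. *)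
exists (m * m'); split; [nia|nia| |].
  by rewrite eq_n mulnC dvdn_mul.
case: H => -[small per]; [left|right]; split.
- move=> b Bb; have /dvdnP[c eb] := multB _ Bb.
  by have := small c; rewrite mulnC -eb; nia.
- move=> x lt_x; rewrite blockA [RHS]blockA per ?div_mod //.
  by rewrite ltn_divLR // -eq_n.
- move=> a; rewrite blockA => /small; rewrite ltn_divLR //; nia.
(* Off the multiples of [m] both sides are false, because reduction modulo [m * m'] preserves the
   residue modulo [m]. *)
- move=> x lt_x; have [/dvdnP[y ey]|ndvd] := boolP (m %| x).
    by rewrite ey [y * m]mulnC -muln_modr per //; nia.
  rewrite (negbTE (introN idP (fun Bx => negP ndvd (multB _ Bx)))).
  apply/esym/negbTE/negP => /multB.
  by rewrite /dvdn modn_dvdm ?dvdn_mulr //; apply/negP.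
Qed.

End NatTilings.

(** * Return to sets of integers and residues mod [n] *)

Theorem theorem4 (n : nat) (hn : (1 < n)%N) (A B : set int)
    (hA0 : A 0) (hB0 : B 0) (hAB : direct_sum A B (interval_set n))
    (maxA maxB : int) (hmaxA : is_max A maxA) (hmaxB : is_max B maxB)
    (hmax : maxA > maxB) :
  periodic_mod n A.
Proof.
have [inE exE] := hAB.
have A_range x : A x -> 0 <= x < n%:Z by move=> Ax; rewrite -[x]addr0; apply: inE.
have B_range x : B x -> 0 <= x < n%:Z by move=> Bx; rewrite -[x]add0r; apply: inE.
pose a : pred nat := fun k => `[< A k%:Z >].
pose b : pred nat := fun k => `[< B k%:Z >].
have A_nat x : A x -> exists2 k : nat, x = k%:Z & a k.
  move=> Ax; have /andP[x0 _] := A_range _ Ax.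
  by exists `|x|%N; [|apply/asboolP]; rewrite gez0_abs.
have B_nat x : B x -> exists2 k : nat, x = k%:Z & b k.
  move=> Bx; have /andP[x0 _] := B_range _ Bx.
  by exists `|x|%N; [|apply/asboolP]; rewrite gez0_abs.
have tab : tiling n a b.
  split=> [k l /asboolP Ak /asboolP Bl|g lt_g|k l k' l'].
  - by have := inE _ _ Ak Bl; rewrite /interval_set /=; lia.
  - have [|[x y] [[/= Ax By e] _]] := exE g%:Z.
      by rewrite /interval_set /=; lia.
    have [k ek ak] := A_nat _ Ax; have [l el bl] := B_nat _ By.
    by exists k, l; split=> //; lia.
  - move=> /asboolP Ak /asboolP Bl /asboolP Ak' /asboolP Bl' e.
    have [p [_ uniq_p]] := exE _ (inE _ _ Ak Bl).
    have e1 := uniq_p (k%:Z, l%:Z) (And3 Ak Bl erefl).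
    have e' : k%:Z + l%:Z = k'%:Z + l'%:Z by rewrite -!PoszD e.
    have e2 := uniq_p (k'%:Z, l'%:Z) (And3 Ak' Bl' e').
    by have [] : (k%:Z, l%:Z) = (k'%:Z, l'%:Z) by rewrite -e1 -e2.
have [m [m0 lt_mn /dvdnP[q eq_n] H]] := tiling_top_period hn tab.
(* In the swapped case [B] would contain [n - m], as it contains 0, and
   [maxA < m <= n - m <= maxB]. *)
have [small per] : top_period n m a b.
  case: H => // -[small per].
  have [k ek ak] := A_nat _ (proj1 hmaxA).
  have : b (n - m)%N.
    rewrite per; last by lia.
    by rewrite eq_n -{2}[m]mul1n -mulnBl modnMl; apply/asboolP.
  move=> /asboolP /(proj2 hmaxB) le_b; have lt_k := small _ ak.
  have q2 : (1 < q)%N by nia.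
  have : (m <= n - m)%N by nia.
  by lia.
have up k : a k -> (k + m < n)%N -> a (k + m)%N.
  by move=> ak lt_k; rewrite per // modnDr -per //; lia.
have a_lt k : a k -> (k < n)%N by move=> /asboolP/A_range /=; lia.
have mod_n k : (k + n)%:Z%:~R = k%:Z%:~R :> 'Z_n.
  by rewrite -!pmulrn natrD pchar_Zp // addr0.
exists m%:R; split.
  apply/eqP => /(congr1 (@nat_of_ord _)).
  by rewrite val_Zp_nat //= modn_small //; lia.
apply/seteqP; split=> [_ [x Ax <-]|_ [_ [x Ax <-] <-]].
  have [k -> ak] := A_nat _ Ax; have lt_k := a_lt _ ak.
  (* The preimage of [k] under the shift by [m] is [k - m], or [k - m + n] after wrapping around;
     the latter stays in [A] because [m] divides [n]. *)
  have [le_mk|lt_km] := leqP m k.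
    exists (k - m)%:Z%:~R; last by rewrite -!pmulrn -natrD subnK.
    exists (k - m)%N%:Z => //; apply/asboolP.
    have -> : `[< A (k - m)%N >] = a (k - m)%N by [].
    by rewrite per; [rewrite -(modnDr _ m) subnK // -per | lia].
  exists (k + (n - m))%N%:Z%:~R; last first.
    by rewrite -[RHS]mod_n -!pmulrn -natrD; congr (_%:R); lia.
  exists (k + (n - m))%N%:Z => //; apply/asboolP.
  have -> : `[< A (k + (n - m))%N >] = a (k + (n - m))%N by [].
  rewrite per; last by lia.
  by rewrite eq_n -{2}[m]mul1n -mulnBl addnC modnMDl -per.
have [k -> ak] := A_nat _ Ax; have lt_k := a_lt _ ak.
(* The same wrap-around in the other direction. *)
have [lt_km|le_n] := ltnP (k + m) n.
  exists (k + m)%N%:Z; last by rewrite -!pmulrn natrD.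
  exact/asboolP/up.
exists (k + m - n)%N%:Z; last first.
  by rewrite -mod_n -!pmulrn -natrD; congr (_%:R); lia.
apply/asboolP; have -> : `[< A (k + m - n)%N >] = a (k + m - n)%N by [].
rewrite per; last by lia.
by rewrite -(modnMDl q) -eq_n subnKC // modnDr -per.
Qed.
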